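(* Let $R$ be a finite commutative chain ring, $n\ge1$, and let $\mathrm{wt}$ be an additive weight on $R^n$. Let $\mathcal{P}=I_0\mid\cdots\mid I_m$ be either the Lee partition of $R$ ($\mathrm{wt}$ arbitrary), or the homogeneous weight-unit partition of $R$ (if $\mathrm{wt}$ is the homogeneous weight and $R$ has nilpotency index $s>1$), or the subfield-trace partition (if $R=\mathbb{F}_{p^r}$ and $\mathrm{wt}$ is the $\lambda$-subfield weight). Let $\pi^{(0)},\dots,\pi^{(D-1)}$ be the $\mathcal{P}$-decompositions of elements of $R^n$, with $\pi^{(0)}=(n,0,\dots,0)$ that of the zero vector. Let $d$ be the minimum distance of some nonzero $R$-linear code in $R^n$, and let $B_R(n,d)$ be the maximum number of codewords of an $R$-linear code of length $n$ and minimum $\mathrm{wt}$-distance $d$. Then $$B_R(n,d)\le\max\sum_{i=0}^{D-1}A_i,$$ where the maximum is over all real tuples $(A_0,\dots,A_{D-1})$ such that (i) $A_0=1$; (ii) $A_i\ge0$ for all $1\le i\le D-1$, and $A_i=0$ for all $i\in I$, where $I=\{i\ge1:\text{there is }x\in R^n\text{ with }\pi(x)=\pi^{(i)}\text{ and }\mathrm{wt}(x)<d\}$; (iii) $\sum_{i=0}^{D-1}A_i\,K_{\pi^{(j)}}(\pi^{(i)})\ge0$ for all $0\le j\le D-1$.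
   Context: A weight on $R$ is a function $\mathrm{wt}:R\to\mathbb{Q}$ with $\mathrm{wt}(0)=0$, $\mathrm{wt}(x)>0$ for $x\neq0$, $\mathrm{wt}(-x)=\mathrm{wt}(x)$, $\mathrm{wt}(x+y)\le\mathrm{wt}(x)+\mathrm{wt}(y)$; it is extended additively to $R^n$ by $\mathrm{wt}(x)=\sum_i\mathrm{wt}(x_i)$. The distance is $\mathrm{wt}(x-y)$, and the minimum distance of a nonzero linear code (an $R$-submodule of $R^n$) is the minimum weight of its nonzero codewords. Partitions of $R$ (maximal ideal $\langle\gamma\rangle$, nilpotency index $s$, residue field size $q$), with $I_0=\{0\}$ always: the Lee partition has blocks $\{a,-a\}$; the homogeneous weight-unit partition has blocks $\{0\}$, $R^\times$, $\langle\gamma^{s-1}\rangle\setminus\{0\}$, $\langle\gamma\rangle\setminus\langle\gamma^{s-1}\rangle$; the subfield-trace partition of $\mathbb{F}_{p^r}$ has blocks $\{0\}$, $\mathbb{F}_p^\times$, $\{x\notin\mathbb{F}_p:\operatorname{Tr}(x)=0\}$, $\{x\notin\mathbb{F}_p:\operatorname{Tr}(x)\neq0\}$, where $\operatorname{Tr}:\mathbb{F}_{p^r}\to\mathbb{F}_p$ is the trace (empty blocks omitted). The homogeneous weight: $0$ at $0$, $1$ off the socle $\langle\gamma^{s-1}\rangle$, $\frac{q}{q-1}$ on nonzero socle elements. The $\lambda$-subfield weight ($\lambda\ge1$ rational): $0$ at $0$, $1$ on $\mathbb{F}_p^\times$, $\lambda$ on $\mathbb{F}_{p^r}\setminus\mathbb{F}_p$.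 Both extended additively. The $\mathcal{P}$-decomposition of $x\in R^n$ is $\pi(x)=(\pi_0,\dots,\pi_m)$, $\pi_i=|\{k:x_k\in I_i\}|$. The variable $A_i$ represents the number of codewords with decomposition $\pi^{(i)}$. Krawtchouk coefficient: fix a character $\psi$ of $(R,+)$ whose kernel contains no nonzero ideal. Then $K_{\pi^{(j)}}(\pi^{(i)})=\sum_{x\in R^n,\ \pi(x)=\pi^{(j)}}\psi\bigl(\sum_ka_kx_k\bigr)$ for any $a\in R^n$ with $\pi(a)=\pi^{(i)}$; for these partitions this does not depend on the choice of $a$.
   Formalization: For the subfield-trace partition the character is required to be trivial on the kernel of Tr, or else to give Krawtchouk coefficients independent of the chosen a; for other generating characters (e.g. x -> (-1)^Tr(wx) on F_4) the coefficients are not well defined. *)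

(* Defs.v *)
From HB Require Import structures.
From mathcomp Require Import all_boot all_order all_algebra all_fingroup all_solvable all_field.
From mathcomp Require Import boolp reals.
From mathcomp Require Import complex.
Set Implicit Arguments.
Unset Strict Implicit.
Unset Printing Implicit Defensive.
Import Order.TTheory GRing.Theory Num.Theory.
Local Open Scope ring_scope.
Local Open Scope complex_scope.

Section Ring.
Variable R : finComUnitRingType.
Implicit Types (J M : {set R}) (g : R) (s : nat).

Definition ideal J : Prop := GRing.submod_closed (mem J : {pred R^o}).

Definition chain_ring : Prop :=
  forall J J', ideal J -> ideal J' -> J \subset J' \/ J' \subset J.

Definition principal g : {set R} := [set x * g | x : R].

Definition maximal_ideal M : Prop :=
  [/\ ideal M, 1 \notin M
    & forall J, ideal J -> 1 \notin J -> M \subset J -> J = M].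

Definition nilpotency_index g s : Prop :=
  forall k : nat, (g ^+ k == 0) = (s <= k)%N.

(* The number of additive cosets of the ideal M, that is, #|R / M|. *)
Definition quotient_size M : nat := #|[set [set x + y | y in M] | x : R]|.

Definition socle g s : {set R} := principal (g ^+ s.-1).

Definition is_weight (wt : R -> rat) : Prop :=
  [/\ wt 0 = 0, forall x, x != 0 -> 0 < wt x, forall x, wt (- x) = wt x
    & forall x y, wt (x + y) <= wt x + wt y].

Definition homogeneous_weight g s (x : R) : rat :=
  let q : rat := (quotient_size (principal g))%:R in
  if x == 0 then 0 else if x \in socle g s then q / (q - 1) else 1.

Definition lee_partition : {set {set R}} := [set [set a; - a] | a : R].

(* Removing [set0] implements the convention that empty blocks are omitted;
   the last block is empty exactly when [s = 2]. *)
Definition homogeneous_partition g s : {set {set R}} :=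
  [set [set 0]; [set x | x \is a GRing.unit]; socle g s :\ 0;
       principal g :\: socle g s] :\ set0.

End Ring.

Section FiniteField.
(* Every finite field of characteristic p, i.e., every F_(p^r).  The type
   [pPrimeCharType charFp] is F, seen as a Galois extension of 'F_p; its
   subspace [1] is the prime subfield. *)
Variables (F : finFieldType) (p : nat) (charFp : p \in [pchar F]).

Definition prime_subfield : {set F} :=
  [set x : F | (x : pPrimeCharType charFp) \in 1%VS].

Definition field_trace (x : F) : F :=
  galTrace 1%AS {: pPrimeCharType charFp} x.

Definition subfield_weight (lambda : rat) (x : F) : rat :=
  if x == 0 then 0 else if x \in prime_subfield then 1 else lambda.

Definition subfield_trace_partition : {set {set F}} :=
  [set [set 0]; prime_subfield :\ 0;
       [set x | (x \notin prime_subfield) && (field_trace x == 0)];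
       [set x | (x \notin prime_subfield) && (field_trace x != 0)]] :\ set0.

End FiniteField.

Section Codes.
Variables (R : finComUnitRingType) (n : nat).
Implicit Types (wt : R -> rat) (C : {set 'rV[R]_n}) (d : rat).

Definition vweight wt (x : 'rV[R]_n) : rat := \sum_k wt (x 0 k).

Definition linear_code C : Prop := GRing.submod_closed (mem C).

(* The first clause of the second conjunct forces C to be nonzero. *)
Definition code_with_min_distance wt d C : Prop :=
  linear_code C /\
  ((exists2 c, c \in C & c != 0 /\ vweight wt c = d) /\
   (forall c, c \in C -> c != 0 -> d <= vweight wt c)).

Definition max_code_size wt d : nat :=
  \max_(C : {set 'rV[R]_n} | `[< code_with_min_distance wt d C >]) #|C|.

(* A partition I_0 | ... | I_m is listed as a function on 'I_m.+1. *)
Definition decomposition m (I : 'I_m.+1 -> {set R}) (x : 'rV[R]_n) :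
    {ffun 'I_m.+1 -> nat} :=
  [ffun i => #|[set k | x 0 k \in I i]|].

Definition zero_decomposition m : {ffun 'I_m.+1 -> nat} :=
  [ffun i => if i == ord0 then n else 0%N].

Definition enumerates_partition m (I : 'I_m.+1 -> {set R})
    (P : {set {set R}}) : Prop :=
  [/\ injective I, I ord0 = [set 0] & [set I i | i : 'I_m.+1] = P].

Definition enumerates_decompositions m (I : 'I_m.+1 -> {set R})
    N (pi : 'I_N.+1 -> {ffun 'I_m.+1 -> nat}) : Prop :=
  [/\ injective pi, pi ord0 = zero_decomposition m
    & forall q, (exists i, pi i = q) <-> (exists x, decomposition I x = q)].

End Codes.

Section Characters.
Variables (K : realType) (R : finComUnitRingType).
Implicit Types psi : R -> K[i].

Definition additive_character psi : Prop :=
  psi 0 = 1 /\ forall x y, psi (x + y) = psi x * psi y.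

Definition generating_character psi : Prop :=
  additive_character psi /\
  forall J : {set R}, ideal J -> {in J, forall x, psi x = 1} -> J = [set 0].

Definition krawtchouk psi n m (I : 'I_m.+1 -> {set R}) (a : 'rV[R]_n)
    (q : {ffun 'I_m.+1 -> nat}) : K[i] :=
  \sum_(x : 'rV[R]_n | decomposition I x == q)
    psi (\sum_k a 0 k * x 0 k).

Definition krawtchouk_independent psi n m (I : 'I_m.+1 -> {set R}) : Prop :=
  forall (a b : 'rV[R]_n) q, decomposition I a = decomposition I b ->
  krawtchouk psi I a q = krawtchouk psi I b q.

End Characters.

(* The three admissible settings.  For the subfield-trace partition, and
   unlike for the other two, a generating character psi need not give
   Krawtchouk coefficients that are independent of the representative: over
   F_4 = {0, 1, w, w^2}, psi x = (-1)^Tr(w x) is generating, while w and w^2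
   lie in the same block and psi (w * 1) <> psi (w^2 * 1).  In that setting
   psi is therefore either a character that factors through the trace, as the
   usual x |-> zeta_p^(Tr x) does, or any other generating character for which
   independence holds. *)
Inductive setting (K : realType) (n m : nat) :
  forall R : finComUnitRingType,
    (R -> rat) -> ('I_m.+1 -> {set R}) -> (R -> K[i]) -> Prop :=
| LeeSetting (R : finComUnitRingType) (wt : R -> rat)
    (I : 'I_m.+1 -> {set R}) (psi : R -> K[i]) of
    enumerates_partition I (lee_partition R) :
    setting n wt I psi
| HomogeneousSetting (R : finComUnitRingType) (g : R) (s : nat)
    (wt : R -> rat) (I : 'I_m.+1 -> {set R}) (psi : R -> K[i]) of
    maximal_ideal (principal g) & nilpotency_index g s & (1 < s)%N
    & wt =1 homogeneous_weight g s
    & enumerates_partition I (homogeneous_partition g s) :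
    setting n wt I psi
| SubfieldTraceSetting (F : finFieldType) (p : nat) (charFp : p \in [pchar F])
    (lambda : rat) (wt : F -> rat) (I : 'I_m.+1 -> {set F}) (psi : F -> K[i]) of
    1 <= lambda & wt =1 subfield_weight charFp lambda
    & enumerates_partition I (subfield_trace_partition charFp)
    & (forall x, field_trace charFp x = 0 -> psi x = 1)
      \/ krawtchouk_independent psi n I :
    setting n wt I psi.

(* [a i] is a vector with decomposition [pi i], so that
   [krawtchouk psi I (a i) (pi j)] is K_{pi j}(pi i).  In K[i], [0 <= z] says
   that z is real and nonnegative. *)
Definition feasible (K : realType) (R : finComUnitRingType) (n m N : nat)
    (wt : R -> rat) (d : rat) (I : 'I_m.+1 -> {set R}) (psi : R -> K[i])
    (pi : 'I_N.+1 -> {ffun 'I_m.+1 -> nat}) (a : 'I_N.+1 -> 'rV[R]_n)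
    (A : 'I_N.+1 -> K) : Prop :=
  [/\ A ord0 = 1,
      forall i, i != ord0 -> 0 <= A i,
      forall i, i != ord0 ->
        (exists x : 'rV[R]_n, decomposition I x = pi i /\ vweight wt x < d) ->
        A i = 0
    & forall j, 0 <= \sum_i (A i)%:C * krawtchouk psi I (a i) (pi j)].

(* Main.v *)
Require Import Defs.
From mathcomp Require Import all_boot all_order all_algebra all_fingroup all_solvable all_field.
From mathcomp Require Import boolp reals.
From mathcomp Require Import complex.
From mathcomp Require classical_sets topology normedtype derive.
Import Order.TTheory GRing.Theory Num.Theory.
Local Open Scope ring_scope.
Local Open Scope complex_scope.

(** The bound is Delsarte's linear programming bound, in the form it takes for
codes that are submodules.  Let [C] be a code of maximal size and let [A i] be
the number of its codewords with decomposition [pi i]; then [\sum_i A i] is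
[#|C|], so it is enough that this [A] is feasible and that the linear program
attains its maximum.

Feasibility rests on two facts.  First, the weight of a vector and the
Krawtchouk coefficients at it depend on its decomposition alone.  The first
half excludes every nonzero decomposition of weight below [d] from [C]; the
second turns [\sum_i A i * K_j(pi i)] into [\sum_(c in C) K_j(c)].  Second,
after an exchange of sums this is the sum, over the vectors [x] with
decomposition [pi j], of [\sum_(c in C) psi (x . c)], the sum of a character
over an additive group, which is either [#|C|] or [0] ([sum_character]).

That Krawtchouk coefficients depend on the decomposition alone reduces to the
one-dimensional statement that the sums [block_sum psi B a] over the blocks [B]
are constant as [a] runs over a block: a Krawtchouk coefficient is a sum of
products of such sums ([krawtchouk_prod]).  For the Lee partition the
one-dimensional statement is the symmetry [x |-> - x].  In the other two cases
every block is obtained by set differences from additive subgroups [H], and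
[block_sum psi H a] only depends on whether [psi] is trivial on [a H].  In a
chain ring with maximal ideal generated by [g] this is governed by
annihilators: that of [g] is the socle, that of the socle is [<g>]
([socle_annihilator], [principal_annihilator]).  In a finite field, either
independence is assumed, or the character factors through the trace; then the
prime subfield and the kernel of the trace are orthogonal to each other
([trace_character_prime], [trace_character_kernel]).

The maximum is attained because the feasible set is a compact polyhedron.  It
is bounded since the sum of [K_j] over all [j] is the sum of a character over
the whole space, hence [#|R^n|] at [0] and [0] elsewhere; adding all
the constraints therefore gives [#|R^n|], while the one for [j = 0], where
[K_j] is [1], contributes [\sum_i A i] and the others are nonnegative
([feasible_bounded]). *)

Set Implicit Arguments.
Unset Strict Implicit.

(** * Character sums over additive groups *)

(** If [chi x0 != 1] for some [x0] in [H], translating by [x0] multiplies the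
sum by [chi x0] and permutes its terms, so the sum vanishes. *)
Lemma sum_character (K : idomainType) (V : finZmodType) (chi : V -> K)
    (H : {set V}) :
  zmod_closed (mem H) -> {in H &, {morph chi : x y / x + y >-> x * y}} ->
  \sum_(x in H) chi x = if [forall x in H, chi x == 1] then #|H|%:R else 0.
Proof.
move=> [H0 HB] chiD; case: ifPn => [/forall_inP chi1|].
  by rewrite (eq_bigr (fun=> 1)) ?sumr_const // => x /chi1/eqP.
rewrite negb_forall_in => /exists_inP [x0 Hx0 chi_x0].
have HD x : (x0 + x \in H) = (x \in H).
  have HN y : y \in H -> - y \in H by rewrite -sub0r; exact: HB.
  apply/idP/idP => Hx; first by rewrite -[x](addKr x0) addrC HB.
  by rewrite -[x]opprK HB ?HN.
have : (chi x0 - 1) * \sum_(x in H) chi x = 0.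
  rewrite mulrBl mul1r mulr_sumr; apply/eqP; rewrite subr_eq0; apply/eqP.
  rewrite [RHS](reindex_inj (addrI x0)) /=.
  by apply: eq_big => [x|x Hx]; rewrite ?HD // chiD.
by move/eqP; rewrite mulf_eq0 subr_eq0 (negPf chi_x0) => /eqP.
Qed.

Section BlockSums.
Variables (K : realType) (R : finComUnitRingType) (psi : R -> K[i]).

Definition block_sum (B : {set R}) (a : R) : K[i] := \sum_(x in B) psi (a * x).

(** The function [f] stands for the map that sends an element to its block; in
the applications [f] is a tuple of tests or a canonical name of the block. *)
Definition fibre_invariant (T : eqType) (f : R -> T) (B : {set R}) : Prop :=
  forall a b, f a = f b -> block_sum B a = block_sum B b.

Hypothesis psiP : additive_character psi.

(** A character sum over a subgroup takes only two values, so it is determined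
by whether the character [x |-> psi (a * x)] is trivial there.  The implication
is asked in one direction because it is symmetric in [a] and [b]. *)
Lemma sum_subgroup_invariant (T : eqType) (f : R -> T) (H : {set R}) :
    zmod_closed (mem H) ->
    (forall a b, f a = f b -> {in H, forall x, psi (a * x) = 1} ->
       {in H, forall x, psi (b * x) = 1}) ->
  fibre_invariant f H.
Proof.
move=> Hzmod Htriv a b fab; have [_ psiD] := psiP.
have sumE c : block_sum H c =
    if [forall x in H, psi (c * x) == 1] then #|H|%:R else 0.
  by apply: sum_character => // x y _ _; rewrite mulrDr psiD.
rewrite !sumE; congr (if _ then _ else _).
by apply/eqfun_inP/eqfun_inP; apply: Htriv.
Qed.

Lemma fibre_invariant0 (T : eqType) (f : R -> T) : fibre_invariant f [set 0].
Proof.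
apply: sum_subgroup_invariant => [|a b _ _ x /set1P->].
  split=> [|x y]; first exact: set11.
  by rewrite !inE => /eqP-> /eqP->; rewrite subr0.
by rewrite mulr0; case: psiP.
Qed.

(** Reaches the blocks that are not subgroups from those that are. *)
Lemma fibre_invariantD (T : eqType) (f : R -> T) (A B : {set R}) :
  B \subset A -> fibre_invariant f A -> fibre_invariant f B ->
  fibre_invariant f (A :\: B).
Proof.
move=> sBA invA invB a b fab.
have sumD c : block_sum (A :\: B) c = block_sum A c - block_sum B c.
  rewrite /block_sum [\sum_(x in A) _](big_setID B) /= (setIidPr sBA).
  by rewrite addrC addrK.
by rewrite !sumD (invA a b) ?(invB a b).
Qed.

End BlockSums.

(** * Decompositions and Krawtchouk coefficients *)

Section Krawtchouk.
Variables (R : finComUnitRingType) (n m : nat).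
Variables (I : 'I_m.+1 -> {set R}) (cls : R -> 'I_m.+1).
Hypothesis clsP : forall x i, (x \in I i) = (cls x == i).

Lemma decomposition_cls (x : 'rV[R]_n) i :
  decomposition I x i = #|[set k | cls (x 0 k) == i]|.
Proof. by rewrite ffunE; apply: eq_card => k; rewrite !inE clsP. Qed.

(** Equal decompositions mean equal multisets of coordinate blocks. *)
Lemma eq_decomposition_perm (x y : 'rV[R]_n) :
  decomposition I x = decomposition I y ->
  exists sigma : 'S_n, forall k, cls (y 0 k) = cls (x 0 (sigma k)).
Proof.
move=> xy; pose t (z : 'rV[R]_n) := [tuple cls (z 0 k) | k < n].
have count_t z i : count_mem i (t z) = decomposition I z i.
  rewrite decomposition_cls -sum1_count big_map big_enum_cond -sum1_card.
  by apply: eq_bigl => k; rewrite inE.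
have /tuple_permP [sigma ysigma] : perm_eq (t y) (t x).
  by apply/allP => i _; rewrite /= !count_t xy.
exists sigma => k.
have : tnth (t y) k = tnth [tuple tnth (t x) (sigma i) | i < n] k.
  by congr (tnth _ k); apply: val_inj.
by rewrite !tnth_mktuple.
Qed.

Lemma eq_decomposition_vweight (wt : R -> rat) (x y : 'rV[R]_n) :
    (forall a b, cls a = cls b -> wt a = wt b) ->
  decomposition I x = decomposition I y -> vweight wt x = vweight wt y.
Proof.
move=> wt_cls /eq_decomposition_perm [sigma xy].
rewrite /vweight (reindex_inj (@perm_inj _ sigma)) /=.
by apply: eq_bigr => k _; apply/esym/wt_cls.
Qed.

Variables (K : realType) (psi : R -> K[i]).
Hypothesis psiP : additive_character psi.

Lemma additive_character_sum (J : Type) (r : seq J) (F : J -> R) :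
  psi (\sum_(k <- r) F k) = \prod_(k <- r) psi (F k).
Proof. by case: psiP => psi0 psiD; apply: (big_morph psi psiD psi0). Qed.

(** Sorting the vectors [x] by the word [t] of blocks of their coordinates makes
each part of the sum a full product, over which the character factors. *)
Lemma krawtchouk_prod (a : 'rV[R]_n) (q : {ffun 'I_m.+1 -> nat}) :
  krawtchouk psi I a q =
  \sum_(t : {ffun 'I_n -> 'I_m.+1} | [forall i, #|[set k | t k == i]| == q i])
     \prod_k block_sum psi (I (t k)) (a 0 k).
Proof.
pose u (x : 'rV[R]_n) : {ffun 'I_n -> 'I_m.+1} := [ffun k => cls (x 0 k)].
rewrite /krawtchouk (partition_big u
  (fun t => [forall i, #|[set k | t k == i]| == q i])) /=; last first.
  move=> x /eqP <-; apply/forallP => i; rewrite decomposition_cls.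
  by apply/eqP/eq_card => k; rewrite !inE ffunE.
apply: eq_bigr => t /eqfunP tq.
rewrite bigA_distr_big_dep.
rewrite (reindex (fun f : {ffun 'I_n -> R} => \row_k f k)) /=; last first.
  exists (fun x : 'rV[R]_n => [ffun k => x 0 k]) => [f|x] _.
    by apply/ffunP => k; rewrite ffunE mxE.
  by apply/rowP => k; rewrite mxE ffunE.
apply: eq_big => [f|f _].
  have -> : (f \in family (fun k => mem (I (t k)))) = (u (\row_k f k) == t).
    apply/familyP/eqP => [ft|<- k].
      by apply/ffunP => k; have := ft k; rewrite ffunE mxE clsP => /eqP.
    by rewrite clsP ffunE mxE.
  apply: andb_idl => /eqP ut; apply/eqP/ffunP => i.
  rewrite decomposition_cls -tq; apply: eq_card => k.
  by rewrite !inE -ut ffunE.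
by rewrite additive_character_sum; apply: eq_bigr => k _; rewrite mxE.
Qed.

(** A permutation [sigma] matching the blocks of [a] with those of [b] permutes
the words [t] in [krawtchouk_prod] and preserves how often each block occurs
in them. *)
Lemma block_sums_krawtchouk_independent :
  (forall i, fibre_invariant psi cls (I i)) -> krawtchouk_independent psi n I.
Proof.
move=> invI a b q /eq_decomposition_perm [sigma ab].
pose act (t : {ffun 'I_n -> 'I_m.+1}) := [ffun k => t (sigma k)].
have act_inj : injective act.
  move=> t t' /ffunP tt'; apply/ffunP => k.
  by have := tt' ((sigma^-1)%g k); rewrite !ffunE permKV.
rewrite !krawtchouk_prod [RHS](reindex_inj act_inj) /=.
apply: eq_big => [t|t _].
  apply: eq_forallb => i; congr (_ == _).
  rewrite -(card_imset _ (@perm_inj _ (sigma^-1)%g)); apply: eq_card => k.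
  rewrite !inE ffunE; apply/imsetP/idP => [[l]|tk].
    by rewrite inE => tl ->; rewrite permKV.
  by exists (sigma k); rewrite ?inE ?permK.
rewrite [LHS](reindex_inj (@perm_inj _ sigma)) /=.
by apply: eq_bigr => k _; rewrite ffunE; apply/esym/invI.
Qed.

End Krawtchouk.

(** * Partitions into the fibres of a map *)

(** Deciding membership through [f] makes disjointness of the blocks automatic,
and block sums and weights need only be compared along [f]. *)
Definition fibres (R T : finType) (f : R -> T) (P : {set {set R}}) : Prop :=
  (forall B, B \in P -> {in B, forall x y, (y \in B) = (f y == f x)}) /\
  (forall x, exists2 B, B \in P & x \in B).

Lemma fibres_classifier (R T : finType) (f : R -> T) (P : {set {set R}}) m
    (I : 'I_m.+1 -> {set R}) :
  fibres f P -> injective I -> [set I i | i : 'I_m.+1] = P ->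
  exists2 cls : R -> 'I_m.+1, forall x i, (x \in I i) = (cls x == i) &
    forall x y, cls x = cls y -> f x = f y.
Proof.
move=> [satP coverP] I_inj IP.
have PI i : I i \in P by rewrite -IP imset_f.
have inI x : exists i, x \in I i.
  by have [B] := coverP x; rewrite -IP => /imsetP[i _ ->]; exists i.
pose cls x := odflt ord0 [pick i | x \in I i].
have cls_in x : x \in I (cls x).
  rewrite /cls; case: pickP => // no_i.
  by have [j] := inI x; rewrite no_i.
exists cls => [x i|x y xy].
  apply/idP/eqP => [Ii|<-//]; apply: I_inj; apply/setP => y.
  by rewrite (satP _ (PI _) _ (cls_in x)) (satP _ (PI _) _ Ii).
by apply/eqP; rewrite -(satP _ (PI (cls y)) y) // -xy.
Qed.

Lemma mem_nonempty_block (R : finType) (P : {set {set R}}) (B : {set R}) x :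
  x \in B -> B \in P -> exists2 B', B' \in P :\ set0 & x \in B'.
Proof.
move=> Bx PB; exists B => //; rewrite in_setD1 PB andbT.
by apply: contraTneq Bx => ->; rewrite in_set0.
Qed.

(** * Ideals and generating characters *)

Section Ideals.
Variable R : finComUnitRingType.
Implicit Types g x y : R.

Lemma mem_ideal_mul (J : {set R}) r x : ideal J -> x \in J -> r * x \in J.
Proof.
by move=> [J0 Jlin] Jx; rewrite -[r * x]addr0; apply: (Jlin r x 0).
Qed.

Lemma ideal_zmod_closed (J : {set R}) : ideal J -> zmod_closed (mem J).
Proof. exact: GRing.submod_closedB. Qed.

Lemma principalP g x : reflect (exists r, x = r * g) (x \in principal g).
Proof. by apply: (iffP imsetP) => [[r _ ->]|[r ->]]; exists r. Qed.

Lemma principal_ideal g : ideal (principal g).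
Proof.
split=> [|r _ _ /principalP[x ->] /principalP[y ->]]; apply/principalP.
  by exists 0; rewrite mul0r.
by exists (r * x + y); rewrite mulrDl -mulrA.
Qed.

Lemma mem_principal g : g \in principal g.
Proof. by apply/principalP; exists 1; rewrite mul1r. Qed.

Lemma principal_sub x J : ideal J -> x \in J -> principal x \subset J.
Proof.
by move=> Jid Jx; apply/subsetP => _ /principalP[r ->]; apply: mem_ideal_mul.
Qed.

(** The set [a J] is itself an ideal, and a generating character is trivial on
no nonzero ideal. *)
Lemma generating_trivial (K : realType) (psi : R -> K[i]) (J : {set R}) a :
    generating_character psi -> ideal J ->
  {in J, forall x, psi (a * x) = 1} <-> {in J, forall x, a * x = 0}.
Proof.
move=> [[psi0 _] psi_gen] Jid; split=> aJ x Jx; last by rewrite aJ.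
have aJid : ideal [set a * y | y in J].
  have [J0 Jlin] := Jid; split=> [|r _ _ /imsetP[y Jy ->] /imsetP[z Jz ->]].
    by apply/imsetP; exists 0; rewrite ?mulr0.
  apply/imsetP; exists (r * y + z); first exact: (Jlin r y z).
  by rewrite mulrDr mulrCA.
apply/set1P; rewrite -(psi_gen _ aJid) ?imset_f // => _ /imsetP[y Jy ->].
exact: aJ.
Qed.

Lemma idealT : ideal [set: R].
Proof. by split=> [|r x y _ _]; apply: in_setT. Qed.

End Ideals.

(** * The homogeneous weight-unit partition *)

Section ChainRing.
Variables (R : finComUnitRingType) (g : R) (s : nat).
Hypotheses (R_chain : chain_ring R) (g_max : maximal_ideal (principal g)).
Hypotheses (g_nil : nilpotency_index g s) (s_gt1 : (1 < s)%N).

Lemma unit_principal x : (x \is a GRing.unit) = (x \notin principal g).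
Proof.
have [_ gN1 gmax] := g_max.
apply/idP/idP => [Ux|]; last apply: contraNT => xNunit.
  apply: contra gN1 => gx; rewrite -(mulVr Ux).
  exact: mem_ideal_mul (principal_ideal g) gx.
have xN1 : 1 \notin principal x.
  apply: contra xNunit => /principalP[y xy].
  by apply/unitrP; exists y; rewrite [x * y]mulrC.
case: (R_chain (principal_ideal x) (principal_ideal g)) => [sxg|sgx].
  exact: subsetP sxg x (mem_principal x).
by rewrite -(gmax _ (principal_ideal x) xN1 sgx) mem_principal.
Qed.

Let expg_s : g ^+ s = 0. Proof. by apply/eqP; rewrite g_nil. Qed.
Let expg_pred : g ^+ s.-1 != 0.
Proof. by rewrite g_nil -ltnNge ltn_predL ltnW. Qed.
Let expgSpred : g * g ^+ s.-1 = 0.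
Proof. by rewrite -exprS prednK ?expg_s // ltnW. Qed.

(** An element outside [<g>] is a unit and annihilates only [0]. *)
Lemma principal_annihilator x : (x \in principal g) = (x * g ^+ s.-1 == 0).
Proof.
apply/idP/eqP => [/principalP[y ->]|]; first by rewrite -mulrA expgSpred mulr0.
apply: contra_eqT; rewrite -unit_principal => Ux.
by apply: contraNneq expg_pred => xg0; rewrite -(mulKr Ux (g ^+ _)) xg0 mulr0.
Qed.

(** If [x g = 0] but [x] is not in the socle, comparability of ideals gives
[g ^+ s.-1 = y x], with [y] a nonunit, so a multiple of [g]; then
[g ^+ s.-1 = 0], which contradicts the choice of [s]. *)
Lemma socle_annihilator x : (x \in socle g s) = (x * g == 0).
Proof.
apply/idP/eqP => [/principalP[y ->]|xg0].
  by rewrite -mulrA [_ * g]mulrC expgSpred mulr0.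
case: (R_chain (principal_ideal x) (principal_ideal (g ^+ s.-1))) => [sub|sub].
  exact: subsetP sub x (mem_principal x).
have /principalP[y gx] := subsetP sub _ (mem_principal _).
have [Uy|] := boolP (y \is a GRing.unit).
  by apply/principalP; exists y^-1; rewrite gx mulKr.
rewrite unit_principal negbK => /principalP[z yz].
by case/eqP: expg_pred; rewrite gx yz -mulrA [g * x]mulrC xg0 mulr0.
Qed.

Lemma socle_sub : socle g s \subset principal g.
Proof.
apply: principal_sub (principal_ideal g) _; apply/principalP.
by exists (g ^+ s.-2); rewrite -exprSr prednK // ltn_predRL.
Qed.

Definition homogeneous_class (x : R) : bool * bool * bool :=
  (x == 0, x \in socle g s, x \in principal g).

Lemma homogeneous_fibres :
  fibres homogeneous_class (homogeneous_partition g s).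
Proof.
have class_chain x :
    ((x == 0) ==> (x \in socle g s)) &&
    ((x \in socle g s) ==> (x \in principal g)).
  apply/andP; split; apply/implyP; last exact: subsetP socle_sub x.
  by move=> /eqP ->; rewrite socle_annihilator mul0r.
split=> [B|x]; rewrite /homogeneous_partition.
  rewrite in_setD1 !in_setU !in_set1 -!orbA => /andP[_] /or4P[] /eqP-> x Bx y;
    move: Bx; rewrite !inE !xpair_eqE ?unit_principal;
    move: (class_chain x) (class_chain y);
    case: (x == 0); case: (x \in socle g s); case: (x \in principal g);
    by case: (y == 0); case: (y \in socle g s); case: (y \in principal g).
have [x0|xN0] := eqVneq x 0.
  by apply: (mem_nonempty_block (B := [set 0])); rewrite ?inE ?x0 ?eqxx.
have [sx|sNx] := boolP (x \in socle g s).
  apply: (mem_nonempty_block (B := socle g s :\ 0)).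
    by rewrite !inE xN0.
  by rewrite !inE ?eqxx ?orbT.
have [gx|gNx] := boolP (x \in principal g).
  apply: (mem_nonempty_block (B := principal g :\: socle g s)).
    by rewrite !inE sNx.
  by rewrite !inE ?eqxx ?orbT.
apply: (mem_nonempty_block (B := [set x | x \is a GRing.unit])).
  by rewrite inE unit_principal.
by rewrite !inE ?eqxx ?orbT.
Qed.

Lemma homogeneous_weight_class x y :
  homogeneous_class x = homogeneous_class y ->
  homogeneous_weight g s x = homogeneous_weight g s y.
Proof. by rewrite /homogeneous_weight => -[-> -> _]. Qed.

(** The ideals [R], [<g>] and the socle have annihilators [0], the socle and
[<g>]; membership in each of these is recorded by [homogeneous_class]. *)
Lemma homogeneous_block_sums (K : realType) (psi : R -> K[i]) B :
    generating_character psi -> B \in homogeneous_partition g s ->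
  fibre_invariant psi homogeneous_class B.
Proof.
move=> psi_gen; have psiP := psi_gen.1.
have principal_inv h : (forall a b, homogeneous_class a = homogeneous_class b ->
    (a * h == 0) = (b * h == 0)) ->
    fibre_invariant psi homogeneous_class (principal h).
  move=> hab; have hid := principal_ideal h.
  apply: sum_subgroup_invariant => // [|a b /hab ab].
    exact: ideal_zmod_closed.
  move=> /(generating_trivial a psi_gen hid) ah.
  apply/(generating_trivial b psi_gen hid) => _ /principalP[r ->].
  rewrite mulrCA; have /eqP-> : b * h == 0 by rewrite -ab ah ?mem_principal.
  exact: mulr0.
have invR : fibre_invariant psi homogeneous_class [set: R].
  have -> : [set: R] = principal 1.
    apply/esym/setP => x; rewrite inE; apply/principalP.
    by exists x; rewrite mulr1.
  by apply: principal_inv => a b [ab _ _]; rewrite !mulr1.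
have inv_g : fibre_invariant psi homogeneous_class (principal g).
  by apply: principal_inv => a b [_ ab _]; rewrite -!socle_annihilator.
have inv_s : fibre_invariant psi homogeneous_class (socle g s).
  by apply: principal_inv => a b [_ _ ab]; rewrite -!principal_annihilator.
have inv0 := fibre_invariant0 psiP (f := homogeneous_class).
rewrite in_setD1 !in_setU !in_set1 -!orbA => /andP[_] /or4P[] /eqP->.
- exact: inv0.
- have -> : [set x | x \is a GRing.unit] = [set: R] :\: principal g.
    by apply/setP => x; rewrite !inE unit_principal andbT.
  by apply: fibre_invariantD => //; apply: subsetT.
- apply: fibre_invariantD => //; rewrite sub1set socle_annihilator.
  by rewrite mul0r.
- exact: fibre_invariantD socle_sub _ _.
Qed.

End ChainRing.

(** * The Lee partition *)

Section Lee.
Variables (R : finComUnitRingType).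

Definition lee_class (x : R) : {set R} := [set x; - x].

Lemma lee_class_eq x y : lee_class x = lee_class y -> y = x \/ y = - x.
Proof.
move=> xy; have : y \in lee_class x by rewrite xy !inE eqxx.
by rewrite !inE => /orP[] /eqP; [left | right].
Qed.

Lemma lee_fibres : fibres lee_class (lee_partition R).
Proof.
have classN x : lee_class (- x) = lee_class x.
  by rewrite /lee_class opprK setUC.
split=> [_ /imsetP[a _ ->] x Bx y|x]; last first.
  by exists (lee_class x); rewrite ?imset_f // !inE eqxx.
have -> : [set a; - a] = lee_class x.
  by move: Bx; rewrite !inE => /orP[] /eqP->; rewrite ?classN.
apply/idP/eqP => [|<-]; last by rewrite !inE eqxx.
by rewrite !inE => /orP[] /eqP->; rewrite ?classN.
Qed.

Lemma lee_block_sums (K : realType) (psi : R -> K[i]) B :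
  B \in lee_partition R -> fibre_invariant psi lee_class B.
Proof.
move=> /imsetP[c _ ->] a b /lee_class_eq[->//|->].
rewrite /block_sum [RHS](reindex_inj (@oppr_inj R)) /=.
by apply: eq_big => [x|x _]; rewrite ?mulrNN // !inE eqr_oppLR eqr_opp orbC.
Qed.

End Lee.

(** * The subfield-trace partition *)

Section SubfieldTrace.
Variables (F : finFieldType) (p : nat) (charFp : p \in [pchar F]).
Local Notation L := (pPrimeCharType charFp).
Local Notation Fp := (prime_subfield charFp).
Local Notation tr := (field_trace charFp).

(** Turns scaling by the prime subfield into repeated addition, which every
additive map respects. *)
Lemma prime_subfieldP x : reflect (exists k, x = k%:R) (x \in Fp).
Proof.
rewrite inE; apply: (iffP (vlineP _ _)) => [[k ->]|[k ->]].
  by exists k; rewrite -[RHS]mulr1.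
by exists k%:R; rewrite scaler_nat.
Qed.

Lemma prime_subfield0 : 0 \in Fp. Proof. by rewrite inE mem0v. Qed.

Lemma prime_subfieldB : {in Fp &, forall x y, x - y \in Fp}.
Proof. by move=> x y; rewrite !inE => xL yL; exact: (@rpredB L 1%VS). Qed.

Lemma field_traceB : {morph tr : x y / x - y}.
Proof. exact: (raddfB (galTrace 1%AS {: L})). Qed.

Lemma field_trace0 : tr 0 = 0.
Proof. exact: (raddf0 (galTrace 1%AS {: L})). Qed.

Lemma field_trace_nat x k : tr (k%:R * x) = k%:R * tr x.
Proof. by rewrite !mulr_natl; exact: (raddfMn (galTrace 1%AS {: L}) k x). Qed.

Lemma field_traceZ c x : c \in Fp -> tr (c * x) = c * tr x.
Proof. by move=> /prime_subfieldP[k ->]; rewrite field_trace_nat. Qed.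

Lemma field_trace_prime x : tr x \in Fp.
Proof.
rewrite inE; apply: (@mem_galTrace _ L 1%AS {: L}%AS); last exact: memvf.
exact: finField_galois (sub1v _).
Qed.

Lemma prime_subfield_div : {in Fp &, forall x y, x / y \in Fp}.
Proof. by move=> x y; rewrite !inE => xL yL; exact: (@rpred_div L 1%AS). Qed.

Definition subfield_class (x : F) : bool * bool * bool :=
  (x == 0, x \in Fp, tr x == 0).

(** On the nonzero elements of the prime subfield [tr x = x * tr 1], so the
trace test does not split that block: it vanishes on all of them or none. *)
Lemma subfield_fibres :
  fibres subfield_class (subfield_trace_partition charFp).
Proof.
have class_dep x : ((x == 0) ==> (x \in Fp) && (tr x == 0)) &&
    ((x != 0) && (x \in Fp) ==> ((tr x == 0) == (tr 1 == 0))).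
  apply/andP; split; apply/implyP.
    by move=> /eqP->; rewrite prime_subfield0 field_trace0 eqxx.
  move=> /andP[xN0 Fpx]; rewrite -{1}[x]mulr1 field_traceZ // mulf_eq0.
  by rewrite (negPf xN0).
split=> [B|x]; rewrite /subfield_trace_partition.
  rewrite /subfield_class; move: Fp class_dep => S class_dep.
  rewrite in_setD1 !in_setU !in_set1 -!orbA => /andP[_] /or4P[] /eqP-> x Bx y;
    move: Bx; rewrite !inE !xpair_eqE;
    move: (class_dep x) (class_dep y);
    case: (tr 1 == 0); case: (x == 0); case: (x \in S); case: (tr x == 0);
    by case: (y == 0); case: (y \in S); case: (tr y == 0).
have [x0|xN0] := eqVneq x 0.
  apply: (mem_nonempty_block (B := [set 0])); first by rewrite x0 set11.
  by rewrite !in_setU !in_set1 eqxx.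
have [Fpx|FpNx] := boolP (x \in Fp).
  apply: (mem_nonempty_block (B := Fp :\ 0)); first by rewrite in_setD1 xN0.
  by rewrite !in_setU !in_set1 eqxx ?orbT.
have [tr0|trN0] := boolP (tr x == 0).
  apply: (mem_nonempty_block (B := [set x | (x \notin Fp) && (tr x == 0)])).
    by rewrite in_set FpNx.
  by rewrite !in_setU !in_set1 eqxx ?orbT.
apply: (mem_nonempty_block (B := [set x | (x \notin Fp) && (tr x != 0)])).
  by rewrite in_set FpNx.
by rewrite !in_setU !in_set1 eqxx ?orbT.
Qed.

Lemma subfield_weight_class lambda x y :
  subfield_class x = subfield_class y ->
  subfield_weight charFp lambda x = subfield_weight charFp lambda y.
Proof. by rewrite /subfield_weight => -[-> -> _]. Qed.

Section Character.
Variables (K : realType) (psi : F -> K[i]).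
Hypothesis psi_gen : generating_character psi.
Hypothesis psi_tr0 : forall x, tr x = 0 -> psi x = 1.

Let psi0 : psi 0 = 1. Proof. by case: psi_gen => -[]. Qed.
Let psiD x y : psi (x + y) = psi x * psi y.
Proof. by case: psi_gen => -[_ psiD _]; apply: psiD. Qed.

Lemma generating_character_neq1 : exists x, psi x <> 1.
Proof.
apply/existsNP => psi1; have [_ /(_ _ (idealT F))] := psi_gen.
move=> /(_ (fun x _ => psi1 x)) /setP/(_ 1).
by rewrite in_setT in_set1 oner_eq0.
Qed.

Lemma character_natM k x : psi (k%:R * x) = psi x ^+ k.
Proof.
rewrite mulr_natl; elim: k => [|k IHk]; first by rewrite mulr0n.
by rewrite mulrS psiD IHk exprS.
Qed.

(** The kernel of [psi] is no larger than that of the trace: if [psi x = 1] and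
[tr x != 0], every [z] differs from a prime-field multiple of [x] by an element
of trace [0], so [psi] would be trivial. *)
Lemma trace_character_eq1 x : (psi x == 1) = (tr x == 0).
Proof.
apply/eqP/eqP => [psix|]; last exact: psi_tr0.
apply/eqP; apply: contraPT psix => trx psix.
have [z] := generating_character_neq1; case.
have /prime_subfieldP[k kE] : tr z / tr x \in Fp.
  by rewrite prime_subfield_div ?field_trace_prime.
rewrite -[z](subrK (k%:R * x)) psiD character_natM psix expr1n mulr1.
by apply: psi_tr0; rewrite field_traceB field_trace_nat -kE divfK ?subrr.
Qed.

Lemma trace_character_prime a :
  {in Fp, forall x, psi (a * x) = 1} <-> tr a = 0.
Proof.
split=> [aFp|tra0 x Fpx].
  apply/eqP; rewrite -trace_character_eq1 -[a]mulr1 aFp //.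
  by apply/prime_subfieldP; exists 1%N.
by apply: psi_tr0; rewrite mulrC field_traceZ // tra0 mulr0.
Qed.

(** If [x |-> tr (a * x)] vanishes on the kernel of [tr], it is proportional to
[tr], with factor [c = tr (a * x1)] for any [x1] of trace [1].  Since [c] is in
the prime subfield, [tr ((a - c) * x) = 0] for all [x], and [a = c] because
[psi] is generating. *)
Lemma trace_character_kernel a :
  {in [set x | tr x == 0], forall x, psi (a * x) = 1} <-> a \in Fp.
Proof.
split=> [aker|Fpa x]; last first.
  by rewrite inE => /eqP trx; apply: psi_tr0; rewrite field_traceZ // trx mulr0.
have [x1 trx1] : exists x1, tr x1 = 1.
  have [x0 /eqP] := generating_character_neq1; rewrite trace_character_eq1.
  move=> trx0; exists ((tr x0)^-1 * x0); rewrite field_traceZ ?mulVf //.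
  rewrite -[_^-1]mul1r prime_subfield_div ?field_trace_prime //.
  by apply/prime_subfieldP; exists 1%N.
have trM x : tr (a * x) = tr x * tr (a * x1).
  have : psi (a * (x - tr x * x1)) = 1.
    apply: aker; rewrite inE field_traceB field_traceZ ?field_trace_prime //.
    by rewrite trx1 mulr1 subrr.
  move/eqP; rewrite trace_character_eq1 mulrBr field_traceB mulrCA.
  by rewrite (field_traceZ _ (field_trace_prime x)) subr_eq0 => /eqP.
have Fpc := field_trace_prime (a * x1).
have acT : {in [set: F], forall x, psi ((a - tr (a * x1)) * x) = 1}.
  move=> x _; apply: psi_tr0; rewrite mulrBl field_traceB (trM x).
  by rewrite (field_traceZ _ Fpc) mulrC subrr.
have /(_ 1 (in_setT _)) := (generating_trivial _ psi_gen (idealT F)).1 acT.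
by rewrite mulr1 => /eqP; rewrite subr_eq0 => /eqP ->.
Qed.

Lemma subfield_block_sums B :
    B \in subfield_trace_partition charFp ->
  fibre_invariant psi subfield_class B.
Proof.
have psiP := psi_gen.1.
have inv0 := fibre_invariant0 psiP (f := subfield_class).
have zmodFp : zmod_closed (mem Fp).
  by split; [exact: prime_subfield0 | exact: prime_subfieldB].
have zmodK : zmod_closed (mem [set x | tr x == 0]).
  split=> [|x y]; first by rewrite inE field_trace0.
  by rewrite !inE field_traceB => /eqP-> /eqP->; rewrite subr0.
have invFp : fibre_invariant psi subfield_class Fp.
  apply: sum_subgroup_invariant => // a b [_ _ ab].
  move=> /trace_character_prime/eqP; rewrite ab => /eqP.
  by move/trace_character_prime.
have invK : fibre_invariant psi subfield_class [set x | tr x == 0].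
  apply: sum_subgroup_invariant => // a b [_ ab _].
  by move=> /trace_character_kernel; rewrite ab => /trace_character_kernel.
have invF : fibre_invariant psi subfield_class [set: F].
  apply: sum_subgroup_invariant => // [|a b [ab _ _]].
    exact: ideal_zmod_closed (idealT F).
  move=> /(generating_trivial _ psi_gen (idealT F)) aF x _.
  have /eqP-> : b == 0 by rewrite -ab -[a]mulr1 aF ?in_setT.
  by rewrite mul0r.
(* On the prime subfield [tr x = x * tr 1], so the intersection is [Fp] or 0. *)
have invKFp : fibre_invariant psi subfield_class ([set x | tr x == 0] :&: Fp).
  have [tr1|trN1] := boolP (tr 1 == 0).
    suff /setIidPr-> : Fp \subset [set x | tr x == 0] by [].
    apply/subsetP => x Fpx; rewrite in_set -[x]mulr1 field_traceZ //.
    by rewrite (eqP tr1) mulr0.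
  suff -> : [set x | tr x == 0] :&: Fp = [set 0] by [].
  apply/setP => x; rewrite in_setI in_set in_set1.
  apply/andP/eqP => [[trx Fpx]|->].
    move: trx; rewrite -[x]mulr1 field_traceZ // mulf_eq0 (negPf trN1) orbF.
    by move/eqP->; rewrite mul0r.
  by rewrite field_trace0 prime_subfield0 eqxx.
have inv_offK :
    fibre_invariant psi subfield_class ([set x | tr x == 0] :\: Fp).
  rewrite -[_ :\: Fp]set0U -(setDv [set x | tr x == 0]).
  by rewrite -setDIr; apply: fibre_invariantD invK invKFp; apply: subsetIl.
have blockK : [set x | (x \notin Fp) && (tr x == 0)] =
    [set x | tr x == 0] :\: Fp.
  by apply/setP => x; rewrite in_setD !in_set.
rewrite in_setD1 !in_setU !in_set1 -!orbA => /andP[_] /or4P[] /eqP->.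
- exact: inv0.
- by apply: fibre_invariantD => //; rewrite sub1set prime_subfield0.
- by rewrite blockK.
have -> : [set x | (x \notin Fp) && (tr x != 0)] =
    ([set: F] :\: Fp) :\: ([set x | tr x == 0] :\: Fp).
  apply/setP => x; rewrite !in_setD !in_set andbT andbC.
  by case: (x \in _); case: (tr x == 0).
apply: fibre_invariantD inv_offK; first by rewrite setSD ?subsetT.
by apply: fibre_invariantD => //; apply: subsetT.
Qed.

End Character.
End SubfieldTrace.

(** * The three settings *)

Section Settings.
Variables (K : realType) (n m : nat).

(** The alternative leaves room for characters that satisfy independence without
having constant block sums. *)
Lemma fibres_setting (R : finComUnitRingType) (T : finType) (f : R -> T) P
    (wt : R -> rat) (I : 'I_m.+1 -> {set R}) (psi : R -> K[i]) :
  enumerates_partition I P -> fibres f P -> additive_character psi ->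
  (forall x y, f x = f y -> wt x = wt y) ->
  (forall B, B \in P -> fibre_invariant psi f B) \/
    krawtchouk_independent psi n I ->
  exists cls : R -> 'I_m.+1,
    [/\ I ord0 = [set 0], forall x i, (x \in I i) = (cls x == i),
        forall x y, cls x = cls y -> wt x = wt y
      & krawtchouk_independent psi n I].
Proof.
move=> [I_inj I0 IP] fP psiP wt_f indep.
have [cls clsP cls_f] := fibres_classifier fP I_inj IP.
exists cls; split=> // [x y /cls_f/wt_f //|].
case: indep => // invP; apply: (block_sums_krawtchouk_independent clsP) => // i.
by move=> x y /cls_f; apply: invP; rewrite -IP imset_f.
Qed.

Lemma setting_classifier (R : finComUnitRingType) (wt : R -> rat)
    (I : 'I_m.+1 -> {set R}) (psi : R -> K[i]) :
  setting n wt I psi -> chain_ring R -> is_weight wt ->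
  generating_character psi ->
  exists cls : R -> 'I_m.+1,
    [/\ I ord0 = [set 0], forall x i, (x \in I i) = (cls x == i),
        forall x y, cls x = cls y -> wt x = wt y
      & krawtchouk_independent psi n I].
Proof.
case=> {R wt I psi} [R wt I psi IP | R g s wt I psi gmax gnil s1 wtE IP
  | F p charFp lambda wt I psi lambda1 wtE IP tr_indep] Rchain wtP psi_gen.
- apply: (fibres_setting IP (@lee_fibres R) psi_gen.1).
    by move=> x y /lee_class_eq[->//|->]; case: wtP.
  by left; apply: lee_block_sums.
- apply: (fibres_setting IP (homogeneous_fibres Rchain gmax gnil s1) psi_gen.1).
    by move=> x y xy; rewrite !wtE; apply: homogeneous_weight_class.
  by left=> B; apply: homogeneous_block_sums.
apply: (fibres_setting IP (subfield_fibres charFp) psi_gen.1).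
  by move=> x y xy; rewrite !wtE; apply: subfield_weight_class.
by case: tr_indep => [psi_tr|]; [left=> B; apply: subfield_block_sums | right].
Qed.

End Settings.

(** * The linear program of a code *)

Section LinearProgram.
Variables (K : realType) (R : finComUnitRingType) (n m N : nat).
Variables (wt : R -> rat) (I : 'I_m.+1 -> {set R}) (psi : R -> K[i]).
Variables (pi : 'I_N.+1 -> {ffun 'I_m.+1 -> nat}) (a : 'I_N.+1 -> 'rV[R]_n).
Variables (d : rat) (cls : R -> 'I_m.+1).
Hypotheses (clsP : forall x i, (x \in I i) = (cls x == i)).
Hypotheses (wt_cls : forall x y, cls x = cls y -> wt x = wt y).
Hypotheses (I0 : I ord0 = [set 0]) (psi_gen : generating_character psi).
Hypotheses (kraw_indep : krawtchouk_independent psi n I).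
Hypotheses (piP : enumerates_decompositions n I pi).
Hypotheses (aP : forall i, decomposition I (a i) = pi i).

Let psiP : additive_character psi := psi_gen.1.

Definition dot (x y : 'rV[R]_n) : R := \sum_k x 0 k * y 0 k.

Lemma dotC x y : dot x y = dot y x.
Proof. by apply: eq_bigr => k _; rewrite mulrC. Qed.

Lemma dotD x y z : dot x (y + z) = dot x y + dot x z.
Proof.
by rewrite -big_split; apply: eq_bigr => k _; rewrite mxE mulrDr.
Qed.

Lemma sum_character_dot (H : {set 'rV[R]_n}) b :
    zmod_closed (mem H) ->
  \sum_(x in H) psi (dot b x) =
  if [forall x in H, psi (dot b x) == 1] then #|H|%:R else 0.
Proof.
move=> Hzmod; apply: sum_character => // x y _ _.
by rewrite dotD; case: psiP => _ ->.
Qed.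

Lemma decomposition_zero (x : 'rV[R]_n) :
  (decomposition I x == zero_decomposition n m) = (x == 0).
Proof.
have x0P k : (x 0 k == 0) = (cls (x 0 k) == ord0) by rewrite -clsP I0 in_set1.
apply/eqP/eqP => [/ffunP/(_ ord0)|x0].
  rewrite (decomposition_cls clsP) ffunE eqxx => xn.
  apply/rowP => k; rewrite mxE; apply/eqP; rewrite x0P.
  have /setP/(_ k) : [set k | cls (x 0 k) == ord0] = [set: 'I_n].
    by apply/eqP; rewrite eqEcard subsetT cardsT card_ord xn leqnn.
  by rewrite !inE.
apply/ffunP => i; rewrite (decomposition_cls clsP) ffunE.
have clsx k : cls (x 0 k) = ord0 by apply/eqP; rewrite -x0P x0 mxE.
rewrite (eq_card (B := if i == ord0 then mem 'I_n else mem pred0)) => [|k].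
  by case: ifP; rewrite ?card_ord ?card0.
by rewrite inE clsx eq_sym; case: ifP.
Qed.

Lemma sum_decompositions (M : nmodType) (P : pred 'rV[R]_n)
    (F : 'rV[R]_n -> M) :
  \sum_i \sum_(x | P x && (decomposition I x == pi i)) F x = \sum_(x | P x) F x.
Proof.
have [pi_inj _ piE] := piP.
pose idx (x : 'rV[R]_n) := odflt ord0 [pick i | decomposition I x == pi i].
have idxE x i : (idx x == i) = (decomposition I x == pi i).
  rewrite /idx; case: pickP => [j /eqP->|no_i].
    by rewrite (inj_eq pi_inj).
  have [_ /(_ (ex_intro _ x erefl))[j pij]] := piE (decomposition I x).
  by have := no_i j; rewrite pij eqxx.
rewrite [RHS](partition_big idx predT) //=; apply: eq_bigr => i _.
by apply: eq_bigl => x; rewrite idxE.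
Qed.

Lemma krawtchouk_at_zero (b : 'rV[R]_n) : krawtchouk psi I b (pi ord0) = 1.
Proof.
have [_ -> _] := piP; rewrite /krawtchouk (big_pred1 0) => [|x].
  rewrite big1 => [|k _]; last by rewrite mxE mulr0.
  by case: psiP.
exact: decomposition_zero.
Qed.

(** If a coordinate [b 0 k] is nonzero, [psi] is nontrivial on the ideal it
generates, hence on the multiples of the [k]-th basis vector. *)
Lemma sum_krawtchouk (b : 'rV[R]_n) :
  \sum_j krawtchouk psi I b (pi j) = if b == 0 then #|'rV[R]_n|%:R else 0.
Proof.
rewrite /krawtchouk (sum_decompositions xpredT).
transitivity (\sum_(x in [set: 'rV[R]_n]) psi (dot b x)).
  by apply: eq_bigl => x; rewrite inE.
have Tzmod : zmod_closed (mem [set: 'rV[R]_n]).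
  by split=> [|x y]; rewrite !inE.
rewrite (sum_character_dot b Tzmod) cardsT; congr (if _ then _ else _).
apply/forall_inP/eqP => [psi1|-> x _]; last first.
  rewrite /dot big1 => [|k _]; last by rewrite mxE mul0r.
  by apply/eqP; case: psiP.
apply/rowP => k; rewrite mxE.
suff ak0 : {in principal (b 0 k), forall x, 1 * x = 0}.
  by rewrite -[b 0 k]mul1r ak0 ?mem_principal.
apply/(generating_trivial 1 psi_gen (principal_ideal _)).
move=> _ /principalP[r ->]; rewrite mul1r.
have /eqP <- := psi1 (\row_l (if l == k then r else 0)) (in_setT _).
congr psi; rewrite /dot (bigD1 k) //= mxE eqxx big1 ?addr0 1?mulrC // => l lk.
by rewrite mxE (negPf lk) mulr0.
Qed.

(** Adding the constraints over all [j] gives [\sum_j K_j(pi i)], which is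
[#|R^n|] for the zero decomposition and [0] otherwise; the term [j = 0] alone
is [\sum_i A i]. *)
Lemma feasible_bounded (A : 'I_N.+1 -> K) :
  feasible wt d I psi pi a A -> forall i, 0 <= A i <= #|'rV[R]_n|%:R.
Proof.
move=> [A0 Age0 _ Akraw]; have [pi_inj pi0 _] := piP.
have {}Age0 i : 0 <= A i.
  by have [->|/Age0//] := eqVneq i ord0; rewrite A0 ler01.
have a0 i : (a i == 0) = (i == ord0).
  by rewrite -decomposition_zero aP -pi0 (inj_eq pi_inj).
have sumA : (\sum_i A i)%:C <= (#|'rV[R]_n|%:R : K)%:C.
  have -> : (#|'rV[R]_n|%:R : K)%:C =
      \sum_j \sum_i (A i)%:C * krawtchouk psi I (a i) (pi j).
    rewrite exchange_big /= (bigD1 ord0) //= -mulr_sumr sum_krawtchouk.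
    rewrite a0 eqxx A0 rmorph1 mul1r big1 ?addr0 ?rmorph_nat // => i i0.
    by rewrite -mulr_sumr sum_krawtchouk a0 (negPf i0) mulr0.
  rewrite rmorph_sum /= [leRHS](bigD1 ord0) //=.
  rewrite (eq_bigr (fun i => (A i)%:C * krawtchouk psi I (a i) (pi ord0))).
    by rewrite lerDl sumr_ge0.
  by move=> i _; rewrite krawtchouk_at_zero mulr1.
move=> i; rewrite Age0; move: sumA; rewrite lecR; apply: le_trans.
by rewrite (bigD1 i) //= lerDl sumr_ge0.
Qed.

Definition code_distribution (C : {set 'rV[R]_n}) (i : 'I_N.+1) : K :=
  #|[set c in C | decomposition I c == pi i]|%:R.

Lemma sum_code_distribution C : \sum_i code_distribution C i = #|C|%:R.
Proof.
rewrite -natr_sum -sum1_card -(sum_decompositions (mem C)); congr _%:R.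
by apply: eq_bigr => i _; rewrite -sum1_card; apply: eq_bigl => c; rewrite inE.
Qed.

(** Nonnegativity for [j] comes from linearity of [C]: for each [x] the sum of
[psi (x . c)] over [c] in [C] is [#|C|] or [0]. *)
Lemma code_distribution_feasible C :
  code_with_min_distance wt d C ->
  feasible wt d I psi pi a (code_distribution C).
Proof.
move=> [Clin [_ Cmin]]; have [pi_inj pi0 _] := piP.
have Czmod : zmod_closed (mem C) := GRing.submod_closedB Clin.
split=> [|i _|i i0 [x [xi xd]]|j].
- rewrite /code_distribution (eq_card (B := pred1 0)) ?card1 // => c.
  rewrite !inE pi0 decomposition_zero andbC andb_idr // => /eqP->.
  exact: Clin.1.
- exact: ler0n.
- apply/eqP; rewrite pnatr_eq0 cards_eq0; apply/eqP/setP => c; rewrite !inE.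
  apply: contraTF xd => /andP[Cc /eqP ci]; rewrite -leNgt.
  rewrite (eq_decomposition_vweight clsP wt_cls (y := c)) ?xi //.
  apply: Cmin => //; rewrite -decomposition_zero ci -pi0.
  by rewrite (inj_eq pi_inj).
have -> : \sum_i (code_distribution C i)%:C * krawtchouk psi I (a i) (pi j) =
    \sum_(c in C) krawtchouk psi I c (pi j).
  rewrite -(sum_decompositions (mem C)); apply: eq_bigr => i _.
  rewrite rmorph_nat mulr_natl -sumr_const /=.
  apply: eq_big => [c|c]; first by rewrite inE.
  by rewrite inE => /andP[_ /eqP ci]; apply: kraw_indep; rewrite aP ci.
rewrite /krawtchouk exchange_big; apply: sumr_ge0 => x _ /=.
under eq_bigr => c _ do rewrite -/(dot c x) dotC.
by rewrite (sum_character_dot x Czmod); case: ifP.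
Qed.

Lemma max_code_size_attained :
  (exists C : {set 'rV[R]_n}, code_with_min_distance wt d C) ->
  exists2 C : {set 'rV[R]_n}, code_with_min_distance wt d C &
    max_code_size n wt d = #|C|.
Proof.
move=> [C0 C0d].
pose codes := [pred C | `[< @code_with_min_distance R n wt d C >]].
have [|C /asboolP Cd maxC] := @eq_bigmax_cond _ codes (fun C => #|C|).
  by apply/card_gt0P; exists C0; apply/asboolP.
by exists C.
Qed.

End LinearProgram.

(** * Existence of the maximum *)

Section Compactness.
Import classical_sets topology normedtype derive.
Import numFieldNormedType.Exports.
Local Open Scope classical_set_scope.
Variables (K : realType) (N : nat).

Lemma continuous_linear_form (c : 'I_N -> K) :
  continuous (fun v : 'rV[K]_N => \sum_i v 0 i * c i).
Proof.
suff sum_cont s : continuous (fun v : 'rV[K]_N => \sum_(i <- s) v 0 i * c i).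
  exact: sum_cont.
elim: s => [|i s IHs] v.
  by under eq_fun do rewrite big_nil; exact: cst_continuous.
under eq_fun do rewrite big_cons.
have Fv : Filter (nbhs v) by exact: nbhs_filter.
exact: (cvgD (cvgM (@coord_continuous K 1 N 0 i v) (cvg_cst (c i))) (IHs v)).
Qed.

Lemma closed_halfspace (c : 'I_N -> K) b :
  closed [set v : 'rV[K]_N | b <= \sum_i v 0 i * c i].
Proof.
have /continuous_closedP fc := @continuous_linear_form c.
exact: fc _ (@closed_ge K b).
Qed.

Lemma closed_hyperplane (c : 'I_N -> K) b :
  closed [set v : 'rV[K]_N | \sum_i v 0 i * c i = b].
Proof.
have /continuous_closedP fc := @continuous_linear_form c.
exact: fc _ (@closed_eq K b).
Qed.

Lemma closed_bounded_sum_max (P : ('I_N -> K) -> Prop) (M : K) :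
    closed [set v : 'rV[K]_N | P (v 0)] ->
    (forall A, P A -> forall i, 0 <= A i <= M) -> (exists A, P A) ->
  exists2 A, P A & forall A', P A' -> \sum_i A' i <= \sum_i A i.
Proof.
move=> Pclosed Pbound [A0 PA0]; pose S := [set v : 'rV[K]_N | P (v 0)].
have rowK A : (\row_i A i : 'rV[K]_N) 0 = A by apply/funext => i; rewrite mxE.
have Scompact : compact S.
  have box := rV_compact (fun i : 'I_N => @segment_compact K 0 M).
  apply: subclosed_compact Pclosed box _ => v /Pbound Pv i /=.
  by rewrite in_itv /=; exact: Pv.
(* The coefficients [1] make the sum an instance of a linear form. *)
have [| |v] := @EVT_max_rV K N (fun v => \sum_i v 0 i * 1) S _ Scompact.
- by exists (\row_i A0 i); rewrite /S /= rowK.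
- exact/continuous_subspaceT/(@continuous_linear_form (fun=> 1)).
rewrite inE => Pv vmax; exists (v 0) => // A' PA'.
have /vmax : \row_i A' i \in S by rewrite inE /S /= rowK.
by rewrite rowK; under eq_bigr do rewrite mulr1;
   under [X in _ <= X]eq_bigr do rewrite mulr1.
Qed.

End Compactness.

Section FeasibleMaximum.
Import classical_sets topology normedtype derive.
Import numFieldNormedType.Exports.
Local Open Scope classical_set_scope.
Variables (K : realType).

(** Nonnegativity of a complex number is a real equation together with a real
inequality, so the Krawtchouk constraints define a real polyhedron. *)
Lemma combination_ge0 N (A : 'I_N -> K) (k : 'I_N -> K[i]) :
  0 <= \sum_i (A i)%:C * k i <->
  \sum_i A i * complex.Im (k i) = 0 /\ 0 <= \sum_i A i * complex.Re (k i).
Proof.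
have Re_scale i : complex.Re ((A i)%:C * k i) = A i * complex.Re (k i).
  by case: (k i) => x y /=; rewrite mul0r subr0.
have Im_scale i : complex.Im ((A i)%:C * k i) = A i * complex.Im (k i).
  by case: (k i) => x y /=; rewrite mul0r addr0.
rewrite lecE /= !raddf_sum /= (eq_bigr _ (fun i _ => Im_scale i)).
rewrite (eq_bigr _ (fun i _ => Re_scale i)).
by split=> [/andP[/eqP]|[-> ->]]; rewrite ?eqxx.
Qed.

Lemma feasible_max_attained (R : finComUnitRingType) (n m N : nat)
    (wt : R -> rat) (d : rat) (I : 'I_m.+1 -> {set R}) (psi : R -> K[i])
    (pi : 'I_N.+1 -> {ffun 'I_m.+1 -> nat}) (a : 'I_N.+1 -> 'rV[R]_n) (M : K) :
  (forall A, feasible wt d I psi pi a A -> forall i, 0 <= A i <= M) ->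
  (exists A, feasible wt d I psi pi a A) ->
  exists2 A, feasible wt d I psi pi a A &
    forall A', feasible wt d I psi pi a A' -> \sum_i A' i <= \sum_i A i.
Proof.
apply: closed_bounded_sum_max.
pose low i := exists x : 'rV[R]_n, decomposition I x = pi i /\ vweight wt x < d.
pose kraw j i := krawtchouk psi I (a i) (pi j).
have coordE (v : 'rV[K]_N.+1) i : \sum_l v 0 l * (l == i)%:R = v 0 i.
  rewrite (bigD1 i) //= eqxx mulr1 big1 ?addr0 // => l /negPf->.
  exact: mulr0.
have closed_coord_eq i b : closed [set v : 'rV[K]_N.+1 | v 0 i = b].
  have := @closed_hyperplane K _ (fun l : 'I_N.+1 => (l == i)%:R) b.
  by under eq_fun do rewrite coordE.
have closed_coord_ge i b : closed [set v : 'rV[K]_N.+1 | b <= v 0 i].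
  have := @closed_halfspace K _ (fun l : 'I_N.+1 => (l == i)%:R) b.
  by under eq_fun do rewrite coordE.
have -> : [set v : 'rV[K]_N.+1 | feasible wt d I psi pi a (v 0)] =
  [set v | v 0 ord0 = 1] `&`
  (\bigcap_(i in [set i | i != ord0]) [set v | 0 <= v 0 i] `&`
  (\bigcap_(i in [set i | i != ord0 /\ low i]) [set v | v 0 i = 0] `&`
  \bigcap_(j in [set: 'I_N.+1])
    ([set v | \sum_i v 0 i * complex.Im (kraw j i) = 0] `&`
     [set v | 0 <= \sum_i v 0 i * complex.Re (kraw j i)]))).
  apply/seteqP; split=> v /=.
    move=> [v0 vge0 vlow vkraw]; split=> //; split=> //.
    split=> [i [i0 lowi]|j _]; first exact: vlow.
    exact/combination_ge0/vkraw.
  move=> [v0 [vge0 [vlow vkraw]]]; split=> // [i i0 /(conj i0)/vlow //|j].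
  by apply/combination_ge0; apply: vkraw.
apply: closedI; first exact: closed_coord_eq.
apply: closedI; first by apply: closed_bigI => i _; exact: closed_coord_ge.
apply: closedI; first by apply: closed_bigI => i _; exact: closed_coord_eq.
apply: closed_bigI => j _.
by apply: closedI; [exact: closed_hyperplane | exact: closed_halfspace].
Qed.

End FeasibleMaximum.

(* The number D of decompositions is N.+1; the existence of the optimal A is
   part of the claim that the maximum exists. *)
Theorem theorem35 (K : realType) (R : finComUnitRingType) (n m N : nat)
    (wt : R -> rat) (I : 'I_m.+1 -> {set R}) (psi : R -> K[i])
    (pi : 'I_N.+1 -> {ffun 'I_m.+1 -> nat}) (a : 'I_N.+1 -> 'rV[R]_n) (d : rat)
    (R_chain : chain_ring R)
    (n_ge1 : (1 <= n)%N)
    (wtP : is_weight wt)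
    (psiP : generating_character psi)
    (RwtI : setting n wt I psi)
    (piP : enumerates_decompositions n I pi)
    (aP : forall i, decomposition I (a i) = pi i)
    (dP : exists C : {set 'rV[R]_n}, code_with_min_distance wt d C) :
  exists A : 'I_N.+1 -> K,
    [/\ feasible wt d I psi pi a A,
        forall A' : 'I_N.+1 -> K, feasible wt d I psi pi a A' ->
          \sum_i A' i <= \sum_i A i
      & (max_code_size n wt d)%:R <= \sum_i A i].
Proof.
have [cls [I0 clsP wt_cls kraw_indep]] :=
  setting_classifier RwtI R_chain wtP psiP.
have [C Cd maxC] := max_code_size_attained dP.
have C_feas : feasible wt d I psi pi a (code_distribution K I pi C).
  exact: (code_distribution_feasible clsP).
have bounded := feasible_bounded clsP I0 psiP piP aP.
have [A A_feas Amax] :=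
  feasible_max_attained (bounded wt d) (ex_intro _ _ C_feas).
exists A; split=> //.
by rewrite maxC -(sum_code_distribution _ piP); apply: Amax.
Qed.
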